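(* Let $(G,Z,\delta)$ be a new setup and let $f,g,h$ be the mappings on $G^3$ given by $f(x,y,z)=\delta([x,y],z)$, $g(x,y,z)=f(x,y,z)f(y,z,x)f(z,x,y)$, $h(x,y,z)=[x,[y,z]]$. Then: (i) $z^{-xy}z^{yx}=[z,[y^{-1},x^{-1}]]$ and $f(z,x,y)=h(z,y,x)f(z,y,x)$ for all $x,y,z\in G$; moreover $[G,G']\le Z$, $\mathrm{cl}(G/Z)\le 2$ and $\mathrm{cl}(G)\le 3$; (ii) $f$ is multiplicative, $\mathrm{Mul}\,\delta\le\mathrm{Rad}\,f$, and $f(x,y,z)=f(y,x,z)^{-1}$ for all $x,y,z\in G$; (iii) $g$ is multiplicative, $\mathrm{Rad}\,f\le\mathrm{Rad}\,g$, and $g(x,y,z)=g(y,z,x)=g(y,x,z)^{-1}$ for all $x,y,z\in G$; (iv) $h$ is multiplicative, $\mathrm{Im}\,h\le Z$, $\mathrm{Rad}\,f\le\mathrm{Rad}\,h$, and $h(x,y,z)=h(x,z,y)^{-1}$ for all $x,y,z\in G$; (v) $G/\mathrm{Rad}\,g$ is an elementary abelian $2$-group, and the mapping $g:G^3\to Z$ induces a trilinear alternating mapping $(G/\mathrm{Rad}\,g)^3\to\{a\in Z: a^2=1\}$.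
   Context: Conventions: $x^y=y^{-1}xy$, $z^{-xy}=(z^{-1})^{xy}$, $[x,y]=x^{-1}y^{-1}xy$; $G'$ is the derived subgroup, $Z(G)$ the center, $\mathrm{cl}(G)$ the nilpotency class of a group $G$. A new setup $(G,Z,\delta)$ consists of a group $G$, a subgroup $Z\le Z(G)$ and a mapping $\delta:G/Z\times G/Z\to Z$ (written $\delta(x,y)$ for $\delta(xZ,yZ)$, and also regarded as a mapping $G\times G\to Z$) such that: $\delta(x,x)=1$ for every $x\in G$; $\delta(x,y)=\delta(y,x)^{-1}$ for every $x,y\in G$; $\delta(xy,z)=\delta(x,z)\delta(y,z)$ whenever $x,y,z\in G$ and $\{x,y,z\}\cap G'\neq\emptyset$; $z^{yx}\delta([z,y],x)=z^{xy}\delta([z,x],y)$ for every $x,y,z\in G$. $\mathrm{Mul}\,\delta$ is the set (a subgroup) of all $t\in G$ such that for all $x,y\in G$: $\delta(tx,y)=\delta(t,y)\delta(x,y)=\delta(xt,y)$, $\delta(x,ty)=\delta(x,t)\delta(x,y)=\delta(x,yt)$, $\delta(xy,t)=\delta(x,t)\delta(y,t)$, $\delta(t,xy)=\delta(t,x)\delta(t,y)$. A mapping $\varphi:G^3\to H$ into an abelian group is multiplicative if it is a homomorphism in each argument when the other two are fixed; for such $\varphi$, $\mathrm{Rad}\,\varphi=\{t\in G:\varphi(t,x,y)=\varphi(x,t,y)=\varphi(x,y,t)=1\text{ for all }x,y\in G\}$, a normal subgroup containing $G'$. A mapping $\varphi$ of three arguments is alternating if $\varphi(x_1,x_2,x_3)=\varphi(x_{\sigma(1)},x_{\sigma(2)},x_{\sigma(3)})^{\mathrm{sgn}(\sigma)}$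 for all $x_i$ and all permutations $\sigma$ of $\{1,2,3\}$. *)

(* Defs.v *)
From HB Require Import structures.
From mathcomp Require Import all_boot fingroup perm generic_quotient.
From mathcomp Require Import boolp classical_sets.
Set Implicit Arguments.
Unset Strict Implicit.
Unset Printing Implicit Defensive.
Local Open Scope group_scope.
Local Open Scope quotient_scope.
Local Open Scope classical_set_scope.

(* Conjugation [x ^ y = y^-1 * (x * y)] and commutators
   [[~ x, y] = x^-1 * x ^ y] are those of mathcomp.boot.monoid; groups are
   arbitrary (possibly infinite) [groupType]s and subsets are [set]s. *)

Definition is_subgroup (G : groupType) (A : set G) : Prop :=
  group_closed [in A].

Record subgroup (G : groupType) := Subgroup {
  subgroup_set :> set G;
  subgroupP : is_subgroup subgroup_set }.

HB.instance Definition _ (G : groupType) (A : set G) :=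
  SubChoice.copy (set_type A) {x : G | x \in A}.
HB.instance Definition _ (G : groupType) (A : subgroup G) :=
  SubChoice_isSubGroup.Build G [in subgroup_set A]
    (set_type (subgroup_set A)) (subgroupP A).

Definition is_normal (G : groupType) (A : set G) : Prop :=
  forall x y : G, A x -> A (x ^ y).

Record normal_subgroup (G : groupType) := NormalSubgroup {
  normal_group :> subgroup G;
  normalP : is_normal normal_group }.

Definition group_center (G : groupType) : set G :=
  [set z | forall x, commute z x].
Arguments group_center : clear implicits.

Record central_subgroup (G : groupType) := CentralSubgroup {
  central_group : subgroup G;
  centralP : central_group `<=` group_center G }.

Lemma central_is_normal (G : groupType) (Z : central_subgroup G) :
  is_normal (central_group Z).
Proof.
move=> z x Zz; rewrite conjgE (centralP Zz) mulKg; exact: Zz.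
Qed.

Coercion central_normal (G : groupType) (Z : central_subgroup G) :
  normal_subgroup G := NormalSubgroup (@central_is_normal G Z).

Section QuotientGroup.
Variables (G : groupType) (N : normal_subgroup G).

Definition same_coset : rel G := fun x y => x^-1 * y \in (N : set G).

Let N1 : 1 \in (N : set G). Proof. by have [] := subgroupP N. Qed.

Let NV x : x \in (N : set G) -> x^-1 \in (N : set G).
Proof. exact: (group_closedV (subgroupP N)). Qed.

Let NM x y :
  x \in (N : set G) -> y \in (N : set G) -> x * y \in (N : set G).
Proof. exact: (group_closedM (subgroupP N)). Qed.

Let NJ x y : x \in (N : set G) -> x ^ y \in (N : set G).
Proof. by rewrite !inE; exact: normalP. Qed.

Let same_coset_refl : reflexive same_coset.
Proof. by move=> x; rewrite /same_coset mulVg. Qed.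

Let same_coset_sym : symmetric same_coset.
Proof.
by move=> x y; apply/idP/idP => /NV; rewrite /same_coset invgM invgK.
Qed.

Let same_coset_trans : transitive same_coset.
Proof.
by move=> y x z xy yz; have := NM xy yz; rewrite mulgA mulgK.
Qed.

Definition coset_rel :=
  EquivRel same_coset same_coset_refl same_coset_sym same_coset_trans.

Definition quotient_group := {eq_quot coset_rel}.
HB.instance Definition _ := Choice.on quotient_group.
HB.instance Definition _ := EqQuotient.on quotient_group.

Definition coset_class (x : G) : quotient_group := \pi_quotient_group x.

Definition quotient_mul (a b : quotient_group) : quotient_group :=
  coset_class (repr a * repr b).
Definition quotient_inv (a : quotient_group) : quotient_group :=
  coset_class (repr a)^-1.

Lemma coset_class_eq x y :
  coset_class x = coset_class y <-> x^-1 * y \in (N : set G).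
Proof. by split => [/eqquotP|?]; last exact/eqquotP. Qed.

Lemma repr_coset_class x : x^-1 * repr (coset_class x) \in (N : set G).
Proof. by apply/coset_class_eq; rewrite /coset_class reprK. Qed.

Lemma coset_classM x y :
  quotient_mul (coset_class x) (coset_class y) = coset_class (x * y).
Proof.
apply/esym/coset_class_eq.
set u := repr (coset_class x); set v := repr (coset_class y).
have -> : (x * y)^-1 * (u * v) = (x^-1 * u) ^ y * (y^-1 * v).
  by rewrite conjgE invgM !mulgA mulgK.
by rewrite NM ?NJ ?repr_coset_class.
Qed.

Lemma coset_classV x : quotient_inv (coset_class x) = coset_class x^-1.
Proof.
apply/esym/coset_class_eq; rewrite invgK.
have -> : x * (repr (coset_class x))^-1
    = ((x^-1 * repr (coset_class x))^-1) ^ x^-1.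
  by rewrite conjgE invgM !invgK !mulgA mulgK.
by rewrite NJ ?NV ?repr_coset_class.
Qed.

Lemma coset_classW (P : quotient_group -> Prop) :
  (forall x, P (coset_class x)) -> forall a, P a.
Proof. by move=> Px a; rewrite -[a]reprK; apply: Px. Qed.

Lemma quotient_mulA : associative quotient_mul.
Proof.
elim/coset_classW => x; elim/coset_classW => y; elim/coset_classW => z.
by rewrite !coset_classM mulgA.
Qed.

Lemma quotient_mul1 : left_id (coset_class 1) quotient_mul.
Proof. by elim/coset_classW => x; rewrite coset_classM mul1g. Qed.

Lemma quotient_1mul : right_id (coset_class 1) quotient_mul.
Proof. by elim/coset_classW => x; rewrite coset_classM mulg1. Qed.

Lemma quotient_mulV : left_inverse (coset_class 1) quotient_inv quotient_mul.
Proof.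
by elim/coset_classW => x; rewrite coset_classV coset_classM mulVg.
Qed.

Lemma quotient_Vmul : right_inverse (coset_class 1) quotient_inv quotient_mul.
Proof.
by elim/coset_classW => x; rewrite coset_classV coset_classM mulgV.
Qed.

HB.instance Definition _ := isGroup.Build quotient_group
  quotient_mulA quotient_mul1 quotient_1mul quotient_mulV quotient_Vmul.

End QuotientGroup.

Definition generated_subgroup (G : groupType) (A : set G) : set G :=
  smallest (@is_subgroup G) A.

Definition commutator_subgroup (G : groupType) (A B : set G) : set G :=
  generated_subgroup [set [~ a, b] | a in A & b in B].

Definition derived_subgroup (G : groupType) : set G :=
  commutator_subgroup [set: G] [set: G].
Arguments derived_subgroup : clear implicits.

(* Indexed from 0: [lower_central G n] is the (n+1)-st term of the lower
   central series, so that the class is the first n where it vanishes. *)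
Fixpoint lower_central (G : groupType) (n : nat) : set G :=
  if n is m.+1 then commutator_subgroup (@lower_central G m) [set: G]
  else [set: G].
Arguments lower_central : clear implicits.

Definition has_class (G : groupType) (c : nat) : Prop :=
  lower_central G c = [set 1] /\
  forall k : nat, lower_central G k = [set 1] -> (c <= k)%N.

Definition cl_le (G : groupType) (n : nat) : Prop :=
  exists2 c : nat, has_class G c & (c <= n)%N.

Section NewSetup.
Variables (G : groupType) (Z : central_subgroup G).
Variable delta : quotient_group Z -> quotient_group Z -> Z.

Definition deltaG (x y : G) : Z := delta (coset_class Z x) (coset_class Z y).

Definition new_setup : Prop :=
  [/\ forall x : G, deltaG x x = 1,
      forall x y : G, deltaG x y = (deltaG y x)^-1,
      forall x y z : G, [set x; y; z] `&` derived_subgroup G !=set0 ->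
        deltaG (x * y) z = deltaG x z * deltaG y z
    & forall x y z : G,
        z ^ (y * x) * val (deltaG [~ z, y] x)
        = z ^ (x * y) * val (deltaG [~ z, x] y)].

Definition Mul : set G := [set t | forall x y : G,
  [/\ deltaG (t * x) y = deltaG t y * deltaG x y /\
        deltaG t y * deltaG x y = deltaG (x * t) y,
      deltaG x (t * y) = deltaG x t * deltaG x y /\
        deltaG x t * deltaG x y = deltaG x (y * t),
      deltaG (x * y) t = deltaG x t * deltaG y t
    & deltaG t (x * y) = deltaG t x * deltaG t y]].

Definition fmap3 (x y z : G) : Z := deltaG [~ x, y] z.

Definition gmap3 (x y z : G) : Z := fmap3 x y z * fmap3 y z x * fmap3 z x y.

End NewSetup.

Definition hmap3 (G : groupType) (x y z : G) : G := [~ x, [~ y, z]].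

Section TernaryMaps.
Variables (G H : groupType) (phi : G -> G -> G -> H).

Definition multiplicative3 : Prop :=
  [/\ forall b c : G, {morph (fun a => phi a b c) : x y / x * y},
      forall a c : G, {morph (fun b => phi a b c) : x y / x * y}
    & forall a b : G, {morph (fun c => phi a b c) : x y / x * y}].

Definition Rad : set G := [set t | forall x y : G,
  [/\ phi t x y = 1, phi x t y = 1 & phi x y t = 1]].

Definition alternating3 : Prop := forall (x : 'I_3 -> G) (s : 'S_3),
  let p (t : 'S_3) := phi (x (t (inord 0))) (x (t (inord 1))) (x (t (inord 2)))
  in p 1 = if odd_perm s then (p s)^-1 else p s.

Hypothesis phiM : multiplicative3.

Lemma Rad_is_subgroup : is_subgroup Rad.
Proof.
have [M1 M2 M3] := phiM.
have one1 b c : phi 1 b c = 1.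
  by apply: (@mulgI _ (phi 1 b c)); rewrite -M1 !mulg1.
have one2 a c : phi a 1 c = 1.
  by apply: (@mulgI _ (phi a 1 c)); rewrite -M2 !mulg1.
have one3 a b : phi a b 1 = 1.
  by apply: (@mulgI _ (phi a b 1)); rewrite -M3 !mulg1.
split; first by rewrite !inE.
move=> u v; rewrite !inE => Ru Rv x y.
have [u1 u2 u3] := Ru x y; have [v1 v2 v3] := Rv x y; split.
- by apply: (@mulIg _ (phi v x y)); rewrite -M1 mulgVK u1 v1 mulg1.
- by apply: (@mulIg _ (phi x v y)); rewrite -M2 mulgVK u2 v2 mulg1.
- by apply: (@mulIg _ (phi x y v)); rewrite -M3 mulgVK u3 v3 mulg1.
Qed.

Lemma Rad_is_normal : is_normal Rad.
Proof.
have [M1 M2 M3] := phiM.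
move=> t z Rt x y; have [t1 t2 t3] := Rt x y; split.
- by apply: (@mulgI _ (phi z x y)); rewrite -M1 -conjgC M1 t1 mul1g mulg1.
- by apply: (@mulgI _ (phi x z y)); rewrite -M2 -conjgC M2 t2 mul1g mulg1.
- by apply: (@mulgI _ (phi x y z)); rewrite -M3 -conjgC M3 t3 mul1g mulg1.
Qed.

Definition Rad_normal : normal_subgroup G :=
  @NormalSubgroup G (Subgroup Rad_is_subgroup) Rad_is_normal.

End TernaryMaps.

Definition elementary_abelian2 (G : groupType) : Prop :=
  (forall x y : G, commute x y) /\ forall x : G, x ^+ 2 = 1.

(* Main.v *)
Require Import Defs.
From mathcomp Require Import all_boot fingroup perm generic_quotient.
From mathcomp Require Import boolp classical_sets.
Local Open Scope group_scope.
Local Open Scope classical_set_scope.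

(** Everything comes from reading the last axiom of a new setup as
    z^(-xy) z^(yx) = f(z,x,y) f(z,y,x)^-1, together with the formal identity
    z^(-xy) z^(yx) = [z, [y^-1, x^-1]]^(xy).  The right-hand side of the former
    lies in Z, so every double commutator is central, and then
    [y^-1, x^-1] and [y, x] differ by an element of Z.  Hence [G, G'] lies in Z,
    which bounds both classes, and
      h(z,y,x) = f(z,x,y) f(z,y,x)^-1          (commg_commgE).

    Since delta is additive as soon as one argument is in G', and trivial on Z,
    f is multiplicative: expanding [xw, y] only produces the extra factor
    [[x, y], w], which lies in Z.  So g (a product of rotations of f) and h
    (by the formula above) are multiplicative too, and their symmetries and
    radicals are read off from those of f.  For t in Mul delta, f(t,x,y) = 1 is
    seen by evaluating delta at tx = xt[t,x].

    For the last part, the Hall-Witt identity, in which all conjugations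
    disappear because the double commutators are central and h is
    multiplicative, says that the product of h over the cyclic rotations of
    (x, y, z) is 1.  Replacing h by its expression in f, this product is
    g(y,x,z) g(x,y,z)^-1 = g(x,y,z)^-2, so g takes values of order at most 2
    (gmap3_sqr).  Squares and commutators therefore lie in Rad g, and the
    induced trilinear map is symmetric, which for values of order at most 2 is
    the same as alternating. *)

(** * Generated subgroups and the lower central series *)

Lemma generated_subgroup_closed (G : groupType) (A : set G) :
  is_subgroup (generated_subgroup A).
Proof.
split; first by apply/mem_set => B [[B1 _] _]; exact/set_mem.
move=> u v /set_mem Au /set_mem Av; apply/mem_set => B [BS AB].
by apply/set_mem/BS.2; apply/mem_set; [apply: Au | apply: Av].
Qed.

Lemma commutator_mem (G : groupType) (A B : set G) a b :
  A a -> B b -> commutator_subgroup A B [~ a, b].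
Proof. by move=> Aa Bb; apply: sub_gen_smallest; exists a => //; exists b. Qed.

Lemma commutator_derived (G : groupType) (x y : G) :
  derived_subgroup G [~ x, y].
Proof. exact: commutator_mem. Qed.

Lemma commutator_sub (G : groupType) (A B C : set G) :
    is_subgroup C -> (forall a b, A a -> B b -> C [~ a, b]) ->
  commutator_subgroup A B `<=` C.
Proof.
by move=> Csub ABC; apply: smallest_sub => // _ [a Aa [b Bb <-]]; apply: ABC.
Qed.

Lemma is_subgroup1 (G : groupType) : is_subgroup [set (1 : G)].
Proof.
split; first exact/mem_set.
by move=> u v /set_mem -> /set_mem ->; apply/mem_set; rewrite divg1.
Qed.

Lemma group_center_subgroup (G : groupType) : is_subgroup (group_center G).
Proof.
split; first by apply/mem_set => x; apply/commute_sym/commute1.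
move=> u v /set_mem Zu /set_mem Zv; apply/mem_set => x.
by apply/commute_sym/commuteM; [|apply: commuteV]; apply: commute_sym.
Qed.

Lemma lower_central_eq1 (G : groupType) n :
  lower_central G n `<=` group_center G -> lower_central G n.+1 = [set 1].
Proof.
move=> LZ; apply/seteqP; split.
  apply: commutator_sub; first exact: is_subgroup1.
  by move=> a b /LZ Za _; apply/eqP/commgP.
by move=> _ ->; apply/set_mem; have [] := generated_subgroup_closed G
  [set [~ a, b] | a in lower_central G n & b in [set: G]].
Qed.

(** A class is defined as a least index, so one has to be extracted from any
    index at which the series has vanished. *)
Lemma cl_le_lower_central (G : groupType) n :
  lower_central G n = [set 1] -> cl_le G n.
Proof.
move=> Ln; have ex1 : exists k, `[< lower_central G k = [set 1] >].
  by exists n; apply/asboolP.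
case: (ex_minnP ex1) => c /asboolP Lc minc.
exists c; last exact/minc/asboolP.
by split=> // k Lk; apply/minc/asboolP.
Qed.

(** * Cosets and commutators *)

Lemma coset_class_mul (G : groupType) (N : normal_subgroup G) :
  {morph @coset_class G N : x y / x * y}.
Proof. by move=> x y; rewrite -coset_classM. Qed.

Lemma coset_class_inv (G : groupType) (N : normal_subgroup G) :
  {morph @coset_class G N : x / x^-1}.
Proof. by move=> x; rewrite -coset_classV. Qed.

Lemma coset_class1P (G : groupType) (N : normal_subgroup G) x :
  coset_class N x = 1 <-> (N : set G) x.
Proof.
split=> [|Nx]; first by move/esym/coset_class_eq/set_mem; rewrite invg1 mul1g.
by apply/esym/coset_class_eq/mem_set; rewrite invg1 mul1g.
Qed.

Lemma coset_classR (G : groupType) (N : normal_subgroup G) :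
  {morph @coset_class G N : x y / [~ x, y]}.
Proof.
by move=> x y; rewrite !(coset_class_mul, coset_class_inv).
Qed.

Lemma commute_coset_class (G : groupType) (N : normal_subgroup G) (x y : G) :
  commute (coset_class N x) (coset_class N y) <-> (N : set G) [~ x, y].
Proof.
rewrite -coset_class1P coset_classR.
by split=> [/commgP/eqP | /eqP/commgP].
Qed.

(** * Commutator identities *)

(** With a(x,y,z) = x z y^x, each factor is a(x,y,z)^-1 a(y,z,x) up to rotation,
    so the product telescopes and free reduction proves it. *)
Lemma Hall_Witt (G : groupType) (x y z : G) :
  [~ x, y^-1, z] ^ y * [~ y, z^-1, x] ^ z * [~ z, x^-1, y] ^ x = 1.
Proof.
rewrite /commg /conjg !(invgM, invgK, mulgA).
by rewrite !(mulgK, mulgVK, mulVg, mul1g).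
Qed.

Lemma commgMr (G : groupType) (x y z : G) :
  [~ x, y * z] = [~ x, z] * [~ x, y] ^ z.
Proof. by rewrite !commgEl conjgM -mulgA -conjMg mulVKg. Qed.

Lemma commMgl (G : groupType) (x y z : G) :
  [~ x * y, z] = [~ x, z] * [~ [~ x, z], y] * [~ y, z].
Proof.
rewrite /commg /conjg !(invgM, invgK, mulgA).
by rewrite !(mulgK, mulgVK, mulVg, mul1g).
Qed.

(** The formal half of the relation behind the whole proof: the new setup
    axiom shows that the left-hand side is central. *)
Lemma conj_diff_commg (G : groupType) (x y z : G) :
  z^-1 ^ (x * y) * z ^ (y * x) = [~ z, [~ y^-1, x^-1]] ^ (x * y).
Proof.
rewrite /commg /conjg !(invgM, invgK, mulgA).
by rewrite !(mulgK, mulgVK, mulVg, mul1g).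
Qed.

(** * Multiplicative maps of three arguments *)

Lemma morphM_1 (G H : groupType) (u : G -> H) :
  {morph u : x y / x * y} -> u 1 = 1.
Proof. by move=> uM; apply: (@mulgI _ (u 1)); rewrite -uM !mulg1. Qed.

Lemma morphM_inv (G H : groupType) (u : G -> H) :
  {morph u : x y / x * y} -> {morph u : x / x^-1}.
Proof.
by move=> uM x; apply/esym/mulg1_eq; rewrite -uM mulgV morphM_1.
Qed.

Definition commutative_group (H : groupType) := forall a b : H, commute a b.

Section Multiplicative.
Variables (G H : groupType).
Hypothesis HC : commutative_group H.
Implicit Types phi psi : G -> G -> G -> H.

Lemma commutative_mulgACA : @interchange H *%g *%g.
Proof. by move=> a b c d; rewrite -!mulgA (mulgA b) (HC b c) !mulgA. Qed.

Lemma multiplicative3_rot phi :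
  multiplicative3 phi -> multiplicative3 (fun x y z => phi y z x).
Proof.
by move=> [M1 M2 M3]; split=> b c x y; [apply: M3|apply: M1|apply: M2].
Qed.

Lemma multiplicative3_mul phi psi :
  multiplicative3 phi -> multiplicative3 psi ->
  multiplicative3 (fun x y z => phi x y z * psi x y z).
Proof.
move=> [M1 M2 M3] [N1 N2 N3].
split=> b c x y; rewrite ?(M1, N1) ?(M2, N2) ?(M3, N3);
  exact: commutative_mulgACA.
Qed.

Lemma multiplicative3_inv phi :
  multiplicative3 phi -> multiplicative3 (fun x y z => (phi x y z)^-1).
Proof.
by move=> [M1 M2 M3]; split=> b c x y; rewrite (M1, M2, M3) invgM; apply: HC.
Qed.

Lemma multiplicative3_comp (K : groupType) (u : H -> K) phi :
  {morph u : a b / a * b} -> multiplicative3 phi ->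
  multiplicative3 (fun x y z => u (phi x y z)).
Proof.
by move=> uM [M1 M2 M3]; split=> b c x y; rewrite (M1, M2, M3).
Qed.

Lemma morphM_commg (u : G -> H) x y :
  {morph u : x y / x * y} -> u [~ x, y] = 1.
Proof.
move=> uM; apply: (@mulgI _ (u (y * x))).
by rewrite -uM -commgC mulg1 !uM HC.
Qed.

Lemma Rad_commg phi x y : multiplicative3 phi -> Rad phi [~ x, y].
Proof.
move=> [M1 M2 M3] a b; split.
- exact: (@morphM_commg (fun t => phi t a b)).
- exact: (@morphM_commg (fun t => phi a t b)).
- exact: (@morphM_commg (fun t => phi a b t)).
Qed.
End Multiplicative.

(** * The map induced on the quotient by the radical *)

Section RadQuotient.
Variables (G H : groupType) (phi : G -> G -> G -> H).
Hypothesis phiM : multiplicative3 phi.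
Let Q := quotient_group (Rad_normal phiM).
Let cl : G -> Q := @coset_class _ _.

(** Each primed argument is the unprimed one times an element of the radical. *)
Lemma Rad_coset_eq x x' y y' z z' :
  cl x = cl x' -> cl y = cl y' -> cl z = cl z' ->
  phi x y z = phi x' y' z'.
Proof.
have [M1 M2 M3] := phiM.
move=> /coset_class_eq/set_mem Rx /coset_class_eq/set_mem Ry.
move=> /coset_class_eq/set_mem Rz.
rewrite -[x'](mulVKg x) -[y'](mulVKg y) -[z'](mulVKg z).
rewrite M1 M2 M3; have [-> _ _] := Rx (y * (y^-1 * y')) (z * (z^-1 * z')).
have [_ -> _] := Ry x (z * (z^-1 * z')); have [_ _ ->] := Rz x y.
by rewrite !mulg1.
Qed.

Lemma multiplicative3_Rad_quotient :
  exists2 phibar : Q -> Q -> Q -> H, multiplicative3 phibar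
    & forall x y z, phibar (cl x) (cl y) (cl z) = phi x y z.
Proof.
pose phibar (a b c : Q) := phi (repr a) (repr b) (repr c).
have phibarE x y z : phibar (cl x) (cl y) (cl z) = phi x y z.
  by apply: Rad_coset_eq; rewrite /cl /coset_class reprK.
exists phibar => //; have [M1 M2 M3] := phiM.
split=> a b c e; elim/coset_classW: a => x;
  elim/coset_classW: b => y;
  elim/coset_classW: c => z; elim/coset_classW: e => t;
  by rewrite -[_ * _]coset_class_mul !phibarE (M1, M2, M3).
Qed.
End RadQuotient.

(** With values of order at most 2 the sign is invisible, and a map invariant
    under a 3-cycle and a transposition is invariant under all of S_3. *)
Lemma alternating3_sqr1 (G H : groupType) (phi : G -> G -> G -> H) :
    (forall x y z, phi x y z ^+ 2 = 1) ->
    (forall x y z, phi x y z = phi y z x) ->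
    (forall x y z, phi x y z = (phi y x z)^-1) ->
  alternating3 phi.
Proof.
move=> phi2 rot swap x s p.
have inv a b c : (phi a b c)^-1 = phi a b c.
  by apply: mulg1_eq; rewrite -expg2 phi2.
have sym a b c : phi a b c = phi b a c by rewrite swap inv.
have -> : (if odd_perm s then (p s)^-1 else p s) = p s.
  by rewrite /p inv if_same.
have I3 (i : 'I_3) : [\/ i = inord 0, i = inord 1 | i = inord 2].
  by case: i => [[|[|[|//]]] lt_i3]; [apply: Or31 | apply: Or32 | apply: Or33];
    apply: val_inj; rewrite /= inordK.
have s_neq i j : i < 3 -> j < 3 -> i != j -> s (inord i) <> s (inord j).
  move=> i3 j3 /eqP neq_ij /perm_inj/(congr1 val).
  by rewrite /= !inordK.
have := s_neq 0%N 1%N isT isT isT; have := s_neq 0%N 2 isT isT isT.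
have := s_neq 1%N 2 isT isT isT.
rewrite /p !perm1.
(* Injectivity leaves six triples of values; each is reached from the identity
   by a rotation, possibly followed by a swap. *)
by case: (I3 (s (inord 0))) => ->; case: (I3 (s (inord 1))) => ->;
  case: (I3 (s (inord 2))) => -> // _ _ _;
  do [by [] | by rewrite sym | by rewrite rot | by rewrite -rot
     | by rewrite sym rot | by rewrite sym -rot].
Qed.

(** * Consequences of the axioms of a new setup *)

Section Setup.
Variables (G : groupType) (Z : central_subgroup G).
Variable delta : quotient_group Z -> quotient_group Z -> Z.
Hypothesis setup : new_setup delta.
Local Notation d := (deltaG delta).
Local Notation f := (fmap3 delta).
Local Notation g := (gmap3 delta).
Local Notation h := (@hmap3 G).
Local Notation G' := (derived_subgroup G).
Implicit Types x y z t : G.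

Lemma val_central (a : Z) x : commute (val a) x.
Proof. exact: centralP (set_mem (valP a)) x. Qed.

Lemma central_commutative : commutative_group Z.
Proof. by move=> a b; apply: val_inj; rewrite !valM; apply: val_central. Qed.

Lemma deltaMl x y z : G' x \/ G' y \/ G' z -> d (x * y) z = d x z * d y z.
Proof.
have [_ _ dM _] := setup.
move=> G'xyz; apply: dM.
by case: G'xyz => [?|[?|?]]; [exists x | exists y | exists z]; split => //=; auto.
Qed.

Lemma deltaMr x y z : G' x \/ G' y \/ G' z -> d x (y * z) = d x y * d x z.
Proof.
have [_ dC _ _] := setup.
move=> G'xyz; rewrite ![d x _]dC deltaMl; last by tauto.
by rewrite invgM central_commutative.
Qed.

Lemma derived1 : G' 1.
Proof. by rewrite -(commgg 1); apply: commutator_derived. Qed.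

Lemma delta1g x : d 1 x = 1.
Proof.
apply: (@mulgI _ (d 1 x)); rewrite -deltaMl ?mulg1 //.
by left; apply: derived1.
Qed.

Lemma delta_Z a x : (Z : set G) a -> d a x = 1.
Proof.
by move=> Za; rewrite -(delta1g x) /deltaG ((coset_class1P _ Z a).2 Za).
Qed.

(** What the last axiom of a new setup is used for: the right-hand side being a
    value in Z, the left-hand side is central. *)
Lemma conj_diff_f (x y z : G) :
  z^-1 ^ (x * y) * z ^ (y * x) = val (f z x y * (f z y x)^-1).
Proof.
have [_ _ _ dJ] := setup.
rewrite valM gmulfV; apply: (@mulIg _ (val (f z y x))).
by rewrite mulgVK -mulgA dJ conjVg mulKg.
Qed.

(** Comparing the two expressions of z^(-xy) z^(yx); the one in f is central,
    so the conjugation by xy in the other can be dropped. *)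
Lemma commg_commgVE x y z :
  [~ z, [~ y^-1, x^-1]] = val (f z x y * (f z y x)^-1).
Proof.
apply: (conjg_inj (x * y)); rewrite -conj_diff_commg conj_diff_f.
by rewrite conjgE val_central mulKg.
Qed.

Lemma commg_commg_Z x y z : (Z : set G) [~ z, [~ y, x]].
Proof.
by rewrite -[y]invgK -[x]invgK commg_commgVE; apply/set_mem/valP.
Qed.

Lemma commgg_Z x y z : (Z : set G) [~ [~ y, x], z].
Proof.
rewrite -invgR; apply/set_mem/(group_closedV (subgroupP Z))/mem_set.
exact: commg_commg_Z.
Qed.

Lemma lower_central_quotient : lower_central (quotient_group Z) 2 = [set 1].
Proof.
apply: lower_central_eq1; apply: commutator_sub.
  exact: group_center_subgroup.
move=> a b _ _; elim/coset_classW: a => x; elim/coset_classW: b => y.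
move=> c; elim/coset_classW: c => z; rewrite -coset_classR.
by apply/commute_coset_class; apply: commgg_Z.
Qed.

(** The elements whose class in G/Z is central form a subgroup, and it contains
    the commutators, hence G'. *)
Lemma commg_derived_central : commutator_subgroup [set: G] G' `<=` (Z : set G).
Proof.
apply: commutator_sub => [|a b _ G'b]; first exact: subgroupP.
pose C := [set c : G | group_center (quotient_group Z) (coset_class Z c)].
suff /(_ b G'b)/(_ (coset_class Z a)) Cb : G' `<=` C.
  by apply/commute_coset_class/commute_sym/Cb.
apply: commutator_sub => [|x y _ _].
  have [c1 cM] := group_center_subgroup (quotient_group Z).
  split; first exact/mem_set/(set_mem c1).
  move=> u v /set_mem Cu /set_mem Cv; apply/mem_set.
  rewrite /C /= coset_class_mul coset_class_inv.
  by apply/set_mem/cM; apply/mem_set.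
move=> c; elim/coset_classW: c => z.
by apply/commute_coset_class; apply: commgg_Z.
Qed.

Lemma lower_central_setup : lower_central G 3 = [set 1].
Proof.
apply: lower_central_eq1; apply: commutator_sub.
  exact: group_center_subgroup.
move=> a b G'a _; apply: (@centralP _ Z).
(* The series takes commutators on the other side, [G', G]. *)
rewrite -invgR; apply/set_mem/(group_closedV (subgroupP Z))/mem_set.
by apply: commg_derived_central; apply: commutator_mem.
Qed.

(** [y^-1, x^-1] is a conjugate of [y, x], and conjugating [y, x] only multiplies
    it by an element of Z. *)
Lemma commg_commgV x y z : [~ z, [~ y^-1, x^-1]] = [~ z, [~ y, x]].
Proof.
have -> : [~ y^-1, x^-1] = [~ y, x] * [~ [~ y, x], (y * x)^-1].
  rewrite /commg /conjg !(invgM, invgK, mulgA).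
  by rewrite !(mulgK, mulgVK, mulVg, mul1g).
have Zs := centralP (commgg_Z x y (y * x)^-1).
set s := [~ _, (y * x)^-1] in Zs *; rewrite commgMr.
have /commute_sym/commgP/eqP -> : commute s z by apply: Zs.
by rewrite mul1g conjgE -Zs mulKg.
Qed.

(** This expresses h through f, so that h inherits multiplicativity and the
    inclusion of radicals from f. *)
Lemma commg_commgE x y z : h z y x = val (f z x y * (f z y x)^-1).
Proof. by rewrite /hmap3 -commg_commgVE commg_commgV. Qed.

(** The expansion of [xw, y] as [x, y] [[x, y], w] [w, y] has all its factors in
    G', where delta is additive, and the middle one in Z, where it vanishes. *)
Lemma fmap3_morph1 y z : {morph (fun x => f x y z) : x w / x * w}.
Proof.
move=> x w; rewrite /fmap3 commMgl.
have G'c := commutator_derived G.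
rewrite deltaMl; last by right; left.
rewrite deltaMl; last by left.
by rewrite [d [~ _, w] z]delta_Z ?mulg1 //; apply: commgg_Z.
Qed.

Lemma fmap3C x y z : f x y z = (f y x z)^-1.
Proof.
apply: (@mulIg _ (f y x z)); rewrite mulVg /fmap3 -deltaMl.
  by rewrite -[[~ y, x]]invgR mulgV delta1g.
by left; apply: commutator_derived.
Qed.

Lemma fmap3_multiplicative : multiplicative3 f.
Proof.
split=> a b x y.
- exact: fmap3_morph1.
- rewrite ![f a _ _]fmap3C fmap3_morph1 invgM.
  exact: central_commutative.
- by apply: deltaMr; left; apply: commutator_derived.
Qed.

(** Membership in Mul delta makes delta additive on both tx and xt, while
    tx = xt[t,x] and delta is additive along elements of G'; comparing the two
    gives delta([t,x], y) = 1. *)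
Lemma Mul_sub_Rad : Mul delta `<=` Rad f.
Proof.
move=> t Mt.
have ft x y : f t x y = 1.
  have [[dt1 dt2] _ _ _] := Mt x y.
  apply: (@mulgI _ (d (x * t) y)); rewrite mulg1 /fmap3 -deltaMl.
    by rewrite -commgC dt1 dt2.
  by right; left; apply: commutator_derived.
move=> x y; split; rewrite ?ft //; first by rewrite fmap3C ft invg1.
apply: (@morphM_commg _ _ central_commutative (fun u => d u t)) => u v.
by have [] := Mt u v.
Qed.

Lemma gmap3_multiplicative : multiplicative3 g.
Proof.
have fM := fmap3_multiplicative; have frot := multiplicative3_rot _ _ _ fM.
have ZC := central_commutative.
apply: (multiplicative3_mul _ _ ZC _ (fun x y z => f z x y)).
  exact: (multiplicative3_mul _ _ ZC).
exact: multiplicative3_rot.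
Qed.

Lemma gmap3_cyclic x y z : g x y z = g y z x.
Proof. by rewrite /gmap3 -mulgA central_commutative. Qed.

Lemma gmap3C x y z : g x y z = (g y x z)^-1.
Proof.
have ZC := central_commutative.
rewrite /gmap3 (fmap3C x) (fmap3C y z) (fmap3C z x) -!invgM.
by congr _^-1; rewrite mulgA (ZC _ (f y x z)) mulgA.
Qed.

Lemma Rad_fmap3_gmap3 : Rad f `<=` Rad g.
Proof.
move=> t Rt x y; have [t1 t2 t3] := Rt x y; have [u1 u2 u3] := Rt y x.
by rewrite /gmap3 !(t1, t2, t3, u1, u2, u3) !mulg1.
Qed.

Lemma hmap3_multiplicative : multiplicative3 h.
Proof.
have ZC := central_commutative; have fM := fmap3_multiplicative.
pose k x y z := f x z y * (f x y z)^-1.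
have kM : multiplicative3 k.
  apply: (multiplicative3_mul _ _ ZC (fun x y z => f x z y)).
    by have [] := fM; split.
  exact: (multiplicative3_inv _ _ ZC f).
have -> : h = fun x y z => val (k x y z).
  apply/funext => x; apply/funext => y; apply/funext => z.
  exact: commg_commgE.
by apply: multiplicative3_comp kM; apply: valM.
Qed.

Lemma Rad_fmap3_hmap3 : Rad f `<=` Rad h.
Proof.
move=> t Rt x y; have [t1 t2 t3] := Rt x y; have [u1 u2 u3] := Rt y x.
by rewrite !commg_commgE !(t1, t2, t3, u1, u2, u3) !mulgV.
Qed.

(** The Hall-Witt identity with its conjugations and inverses removed:
    [[a, b^-1], c] is central and is the inverse of h(c, a, b^-1). *)
Lemma hmap3_Jacobi x y z : h x y z * h y z x * h z x y = 1.
Proof.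
have [_ _ hM3] := hmap3_multiplicative.
have hE a b c : [~ [~ a, b^-1], c] ^ b = h c a b.
  rewrite conjgE (centralP (commgg_Z _ _ _)) mulKg -invgR.
  by rewrite -[[~ c, _]]/(h c a b^-1) (morphM_inv _ _ (h c a)) ?invgK.
by have := Hall_Witt G y z x; rewrite !hE.
Qed.

(** The cyclic product of h, written in terms of f, is
    g(y,x,z) g(x,y,z)^-1; the swapped triple also gives g(x,y,z)^-1, so this is
    g(x,y,z)^-2. *)
Lemma gmap3_sqr x y z : g x y z ^+ 2 = 1.
Proof.
have ZC := central_commutative; have ACA := commutative_mulgACA _ ZC.
suff gg : g y x z * (g x y z)^-1 = 1.
  by rewrite expg2 {1}gmap3C (divg1_eq gg) mulVg.
apply: val_inj; rewrite val1 -(hmap3_Jacobi x y z) !commg_commgE -!valM.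
rewrite (ACA (f x z y)) (ACA _ _ (f z y x)) /gmap3; congr (val (_ * _)).
  by rewrite (ZC (f x z y)).
by rewrite -!invgM (ZC (f z x y)) (ZC (f y z x)).
Qed.

(** Commutators lie in the radical of any multiplicative map into an abelian
    group; squares do because g has values of order at most 2. *)
Lemma elementary_abelian2_Rad_gmap3 (gM : multiplicative3 g) :
  elementary_abelian2 (quotient_group (Rad_normal gM)).
Proof.
split=> [a b|a]; elim/coset_classW: a => x.
  elim/coset_classW: b => y; apply/commute_coset_class.
  exact: Rad_commg central_commutative _ _ _ gM.
have [M1 M2 M3] := gM.
rewrite expg2 -coset_class_mul; apply/coset_class1P => y z.
by rewrite M1 M2 M3 -!expg2 !gmap3_sqr.
Qed.
End Setup.

Theorem lemma4p1 (G : groupType) (Z : central_subgroup G)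
  (delta : quotient_group Z -> quotient_group Z -> Z)
  (setup : new_setup delta) :
  let f := fmap3 delta in
  let g := gmap3 delta in
  let h := @hmap3 G in
  (* (i) *)
  [/\ [/\ forall x y z : G,
            z^-1 ^ (x * y) * z ^ (y * x) = [~ z, [~ y^-1, x^-1]],
          forall x y z : G, val (f z x y) = h z y x * val (f z y x),
          commutator_subgroup [set: G] (derived_subgroup G) `<=` Z,
          cl_le (quotient_group Z) 2
        & cl_le G 3],
  (* (ii) *)
      [/\ multiplicative3 f,
          Mul delta `<=` Rad f
        & forall x y z : G, f x y z = (f y x z)^-1],
  (* (iii) *)
      [/\ multiplicative3 g,
          Rad f `<=` Rad g
        & forall x y z : G, g x y z = g y z x /\ g y z x = (g y x z)^-1],
  (* (iv) *)
      [/\ multiplicative3 h,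
          forall x y z : G, h x y z \in (Z : set G),
          Rad f `<=` Rad h
        & forall x y z : G, h x y z = (h x z y)^-1]
  (* (v) *)
    & exists gM : multiplicative3 g,
        let Q := quotient_group (Rad_normal gM) in
        elementary_abelian2 Q /\
        exists gbar : Q -> Q -> Q -> Z,
          [/\ multiplicative3 gbar,
              alternating3 gbar,
              forall a b c : Q, gbar a b c ^+ 2 = 1
            & forall x y z : G,
                gbar (coset_class _ x) (coset_class _ y) (coset_class _ z)
                = g x y z]].
Proof.
have fM := fmap3_multiplicative _ _ _ setup.
have gM := gmap3_multiplicative _ _ _ setup.
have hE := commg_commgE _ _ _ setup.
move=> f g h; split.
- split.
  + move=> x y z.
    by rewrite (conj_diff_f _ _ _ setup) (commg_commgVE _ _ _ setup).
  + by move=> x y z; rewrite /h hE -valM mulgVK.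
  + exact: commg_derived_central setup.
  + exact/cl_le_lower_central/(lower_central_quotient _ _ _ setup).
  + exact/cl_le_lower_central/(lower_central_setup _ _ _ setup).
- split; [exact: fM | exact: Mul_sub_Rad setup | exact: fmap3C setup].
- split; [exact: gM | exact: Rad_fmap3_gmap3 |].
  move=> x y z; have gR := gmap3_cyclic _ _ delta.
  by rewrite /g -gR -(gmap3C _ _ _ setup).
- split; [exact: hmap3_multiplicative setup | | exact: Rad_fmap3_hmap3 setup |].
    by move=> x y z; rewrite /h hE; apply: valP.
  by move=> x y z; rewrite /h !hE -gmulfV invgM invgK.
exists gM => Q; split; first exact: elementary_abelian2_Rad_gmap3 setup gM.
have [gbar gbarM gbarE] := multiplicative3_Rad_quotient _ _ _ gM.
have gbar2 a b c : gbar a b c ^+ 2 = 1.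
  elim/coset_classW: a => x; elim/coset_classW: b => y.
  by elim/coset_classW: c => z; rewrite gbarE (gmap3_sqr _ _ _ setup).
exists gbar; split=> //; apply: alternating3_sqr1 => // a b c.
  elim/coset_classW: a => x; elim/coset_classW: b => y.
  by elim/coset_classW: c => z; rewrite !gbarE; apply: gmap3_cyclic.
elim/coset_classW: a => x; elim/coset_classW: b => y.
by elim/coset_classW: c => z; rewrite !gbarE; apply: gmap3C setup _ _ _.
Qed.
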